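(* Let $(\Omega,\Sigma,\mu)$ be a finite or $\sigma$-finite measure space containing three pairwise disjoint sets $\Delta_1,\Delta_2,\Delta_3 \in \Sigma$ of finite positive measure. Then the real Banach space $L_p = L_p(\Omega,\Sigma,\mu)$ is a CCF space for every $p \in (1,2) \cup (2,\infty)$.
   Context: Let $X$ be a Banach space. For a nonempty bounded set $A \subseteq X$ and $x \in X$, put $r(x,A) = \sup_{a \in A}\|x-a\|$ and $F(x,A) = \{a \in A : \|x-a\| = r(x,A)\}$, and let $\mathrm{Far}\,A = \bigcup_{x \in X} F(x,A)$. The Chebyshev radius of $A$ is $r(A) = \inf_{x \in X} r(x,A)$; a point $c \in X$ with $r(c,A) = r(A)$ is called a Chebyshev center of $A$. A set is nontrivial if it has at least two elements. A nonempty bounded set $A$ is a CCF set if some Chebyshev center of $A$ belongs to $\mathrm{Far}\,A$. The space $X$ is CCF if it contains a nontrivial bounded CCF set. *)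

(* Defs.v *)
From HB Require Import structures.
From mathcomp Require Import all_boot all_order all_algebra.
From mathcomp Require Import generic_quotient.
From mathcomp Require Import all_classical all_reals all_analysis.
From mathcomp Require Import measurable_realfun ess_sup_inf. 
From mathcomp Require Import ring lra.

Set Implicit Arguments.
Unset Strict Implicit.
Unset Printing Implicit Defensive.
Import Order.TTheory GRing.Theory Num.Theory numFieldNormedType.Exports.
Local Open Scope classical_set_scope.
Local Open Scope ring_scope.

Section CCF.
Context (R : realType) (X : completeNormedModType R).
Implicit Types (A : set X) (x c : X).

(* The suprema and infima below are taken in R, so [far_radius] and
   [chebyshev_radius] are meaningful only for nonempty bounded A. *)
Definition far_radius x A : R := sup [set `|x - a| | a in A].

Definition farthest_points x A : set X :=
  [set a | A a /\ `|x - a| = far_radius x A].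

Definition Far A : set X := \bigcup_x farthest_points x A.

Definition chebyshev_radius A : R := inf [set far_radius x A | x in [set: X]].

Definition chebyshev_center A c : Prop := far_radius c A = chebyshev_radius A.

Definition nontrivial A : Prop := exists a b, [/\ A a, A b & a <> b].

Definition CCF_set A : Prop :=
  [/\ A !=set0, bounded_set A & exists2 c, chebyshev_center A c & Far A c].

Definition CCF_space : Prop :=
  exists A, [/\ nontrivial A, bounded_set A & CCF_set A].

End CCF.

(* The library defines the type [LspaceType mu p1] of a.e.-classes of measurable
   functions with finite p-norm but puts no algebraic or topological structure
   on it.  We make it a normed space, by operations on representatives, and
   prove that it is complete (Riesz-Fischer) for finite p. *)
Section Lspace_normed.
Context d (T : measurableType d) (R : realType).
Variables (mu : {measure set T -> \bar R}) (p : \bar R) (p1 : (1 <= p)%E).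
Local Notation Lf := (LfunType mu p1).
Local Notation Lp := (LspaceType mu p1).

HB.instance Definition _ := gen_eqMixin Lp.
HB.instance Definition _ := gen_choiceMixin Lp.

Lemma ae_eq_Lnorm (f g : T -> R) :
  measurable_fun setT f -> measurable_fun setT g ->
  ae_eq mu setT f g -> ('N[mu]_p[EFin \o f] = 'N[mu]_p[EFin \o g])%E.
Proof.
move=> mf mg fg; rewrite unlock /Lnorm; case: p p1 => // [r r1|_].
- have mpow (h : T -> R) : measurable_fun setT h ->
      measurable_fun setT (EFin \o (fun x => `|h x| `^ r)).
    move=> mh; apply/measurable_EFinP.
    apply: (@measurableT_comp _ _ _ _ _ _ (@powR R ^~ r)) => //.
    exact: measurableT_comp.
  congr (_ `^ _)%E; apply: ae_eq_integral => //; try exact: mpow.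
  by apply: filterS fg => x /= /[apply] ->.
- case: ifPn => // _; apply: eq_ess_sup.
  by apply: filterS fg => x /= /(_ I) ->.
Qed.


(* [LspaceType] is built by the library on classes of functions into
   [measurableTypeR R], which is R with its Borel sigma-algebra under another
   name; [Lmfun] performs the change of codomain. *)
Definition Lmfun (f : Lf) : T -> measurableTypeR R := f.
Lemma measurable_Lmfun (f : Lf) : measurable_fun setT (Lmfun f).
Proof. exact: (@measurable_funPT _ _ _ _ f). Qed.
HB.instance Definition _ f :=
  @isMeasurableFun.Build _ _ T (measurableTypeR R) (Lmfun f) (measurable_Lmfun f).

Definition Lclass_mfun (f : Lf) : {mfun_ mu, T >-> measurableTypeR R} :=
  (\pi_({mfun_ mu, T >-> measurableTypeR R}) (Lmfun f : {mfun T >-> measurableTypeR R}))%qT.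

Lemma Lclass_mfunK (f : Lf) : ae_eq mu setT (Lclass_mfun f : T -> R) f.
Proof.
have /eqmodP/asboolP := reprK (Lclass_mfun f); exact.
Qed.

Lemma finite_norm_Lclass (f : Lf) : finite_norm mu p (Lclass_mfun f).
Proof.
have mf : measurable_fun setT (Lclass_mfun f : T -> R).
  exact: (@measurable_funPT _ _ _ _ (repr (Lclass_mfun f))).
have mf' : measurable_fun setT f := @measurable_funPT _ _ _ _ f.
rewrite /finite_norm (ae_eq_Lnorm mf mf' (Lclass_mfunK f)).
exact: Lfunction_finite.
Qed.

HB.instance Definition _ f :=
  @isFinLebesgue.Build _ T R mu p p1 (Lclass_mfun f) (finite_norm_Lclass f).

Definition Lclass (f : Lf) : Lp := Lclass_mfun f.

Definition Lrepr_fun (f : Lp) : T -> R := f.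
Lemma measurable_Lrepr (f : Lp) : measurable_fun setT (Lrepr_fun f).
Proof. exact: (@measurable_funPT _ _ _ _ (repr (LebesgueSpace.sort f))). Qed.
Lemma finite_norm_Lrepr (f : Lp) : finite_norm mu p (Lrepr_fun f).
Proof. exact: Lebesgue_finite. Qed.
HB.instance Definition _ f := @isMeasurableFun.Build _ _ T R (Lrepr_fun f) (measurable_Lrepr f).
HB.instance Definition _ f := @isLfunction.Build _ T R mu p p1 (Lrepr_fun f) (finite_norm_Lrepr f).
Definition Lrepr (f : Lp) : Lf := Lrepr_fun f.

Lemma LclassK (f : Lf) : ae_eq mu setT (Lrepr (Lclass f)) f.
Proof. exact: Lclass_mfunK. Qed.

Lemma Lspace_sort_inj (f g : Lp) : LebesgueSpace.sort f = LebesgueSpace.sort g -> f = g.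
Proof.
case: f g => [f [[ff]]] [g [[gf]]] /= fg; subst g.
by congr (LebesgueSpace.Pack (LebesgueSpace.Class (isFinLebesgue.Axioms_ _ _ _ _ _ _ _))).
Qed.

Lemma Lspace_eqP (f g : Lp) : ae_eq mu setT f g -> f = g.
Proof.
move=> fg; apply: Lspace_sort_inj; rewrite -[LHS]reprK -[RHS]reprK.
by apply/eqmodP/asboolP.
Qed.

Lemma eq_Lclass (f g : Lf) : ae_eq mu setT f g -> Lclass f = Lclass g.
Proof.
move=> fg; apply: Lspace_eqP.
exact: (ae_eq_trans (ae_eq_trans (LclassK f) fg) (ae_eq_sym (LclassK g))).
Qed.

Lemma LreprK (f : Lp) : Lclass (Lrepr f) = f.
Proof. by apply: Lspace_eqP; exact: LclassK. Qed.

Definition Lspace_add (f g : Lp) : Lp := Lclass (Lrepr f + Lrepr g).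
Definition Lspace_opp (f : Lp) : Lp := Lclass (- Lrepr f).
Definition Lspace_scale (a : R) (f : Lp) : Lp := Lclass (a *: Lrepr f).
Local Notation add := Lspace_add.
Local Notation opp := Lspace_opp.
Local Notation scale := Lspace_scale.

Lemma add_Lclass f g : add (Lclass f) (Lclass g) = Lclass (f + g).
Proof.
apply: eq_Lclass; apply: filterS2 (LclassK f) (LclassK g) => x /(_ I) fx /(_ I) gx _.
exact: (congr2 +%R fx gx).
Qed.
Lemma opp_Lclass f : opp (Lclass f) = Lclass (- f).
Proof.
apply: eq_Lclass; apply: filterS (LclassK f) => x /(_ I) fx _.
exact: (congr1 -%R fx).
Qed.
Lemma scale_Lclass a f : scale a (Lclass f) = Lclass (a *: f).
Proof.
apply: eq_Lclass; apply: filterS (LclassK f) => x /(_ I) fx _.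
exact: (congr1 ( *%R a) fx).
Qed.

Let addA : associative add.
Proof.
by move=> f g h; rewrite -(LreprK f) -(LreprK g) -(LreprK h) !add_Lclass addrA.
Qed.
Let addC : commutative add.
Proof. by move=> f g; rewrite /add addrC. Qed.
Let add0 : left_id (Lclass 0) add.
Proof. by move=> f; rewrite -(LreprK f) add_Lclass add0r. Qed.
Let addN : left_inverse (Lclass 0) opp add.
Proof. by move=> f; rewrite -(LreprK f) opp_Lclass add_Lclass addNr. Qed.

HB.instance Definition _ := GRing.isZmodule.Build Lp addA addC add0 addN.

Let scaleA a b (f : Lp) : scale a (scale b f) = scale (a * b) f.
Proof. by rewrite -(LreprK f) !scale_Lclass scalerA. Qed.
Let scale1 : left_id 1 scale.
Proof. by move=> f; rewrite -(LreprK f) scale_Lclass scale1r. Qed.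
Let scaleDr : right_distributive scale +%R.
Proof.
move=> a f g; rewrite -(LreprK f) -(LreprK g).
by rewrite [X in scale a X]add_Lclass !scale_Lclass [RHS]add_Lclass scalerDr.
Qed.
Let scaleDl (f : Lp) : {morph scale^~ f : a b / a + b}.
Proof.
move=> a b; rewrite -(LreprK f) !scale_Lclass [RHS]add_Lclass.
by rewrite scalerDl.
Qed.

HB.instance Definition _ :=
  GRing.Zmodule_isLmodule.Build R Lp scaleA scale1 scaleDr scaleDl.

Definition Lspace_norm (f : Lp) : R := fine ('N[mu]_p[EFin \o f])%E.

Local Notation norm := Lspace_norm.

Lemma norm_Lclass (f : Lf) : norm (Lclass f) = fine ('N[mu]_p[EFin \o f])%E.
Proof.
congr fine; apply: ae_eq_Lnorm => //; [|exact: LclassK].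
exact: (measurable_Lrepr (Lclass f)).
Qed.

Let ler_normD (f g : Lp) : norm (f + g) <= norm f + norm g.
Proof.
by rewrite -[X in norm (X + _)]LreprK -[X in norm (_ + X)]LreprK [X in norm X]add_Lclass norm_Lclass ler_LnormD.
Qed.

Let normrZ (a : R) (f : Lp) : norm (a *: f) = `|a| * norm f.
Proof.
rewrite -(LreprK f) [X in norm X]scale_Lclass !norm_Lclass.
by apply: EFin_inj; rewrite EFinM !finite_norm_fine LnormZ.
Qed.

Let normr0_eq0 (f : Lp) : norm f = 0 -> f = 0.
Proof.
rewrite -(LreprK f) norm_Lclass => /fine_Lnormr_eq0 f0.
exact: eq_Lclass.
Qed.

HB.instance Definition _ := @Lmodule_isNormed.Build R Lp
  norm ler_normD normrZ normr0_eq0.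

Lemma LspaceD (f g : Lp) : ae_eq mu setT (f + g : Lp) ((f : T -> R) \+ g).
Proof. exact: (LclassK (Lrepr f + Lrepr g)). Qed.
Lemma LspaceB (f g : Lp) : ae_eq mu setT (f - g : Lp) ((f : T -> R) \- g).
Proof.
have <- : Lclass (Lrepr f - Lrepr g) = f - g.
  by rewrite -[RHS](_ : add f (opp g) = _)// -{2}[f]LreprK add_Lclass.
exact: LclassK.
Qed.
Lemma LspaceZ a (f : Lp) : ae_eq mu setT (a *: f : Lp) (fun x => a * f x).
Proof. exact: (LclassK (a *: Lrepr f)). Qed.
Lemma LspaceN (f : Lp) : ae_eq mu setT (- f : Lp) (fun x => - f x).
Proof. exact: (LclassK (- Lrepr f)). Qed.
Lemma Lspace_normE (f : Lp) : `|f| = fine ('N[mu]_p[EFin \o f])%E.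
Proof. by []. Qed.
Lemma Lspace_norm_Lclass (f : Lf) : `|Lclass f| = fine ('N[mu]_p[EFin \o f])%E.
Proof. exact: norm_Lclass. Qed.
Lemma Lspace_norm_EFin (f : Lp) : `|f|%:E = ('N[mu]_p[EFin \o f])%E.
Proof. exact: (finite_norm_fine (Lrepr f)). Qed.

End Lspace_normed.

Section Lspace_complete.
Context d (T : measurableType d) (R : realType).
Variables (mu : {measure set T -> \bar R}) (r : R) (r1 : (1 <= r%:E)%E).
Local Notation Lf := (LfunType mu r1).
Local Notation Lp := (LspaceType mu r1).
Local Notation "'N[ f ]" := ('N[mu]_r%:E[EFin \o f%R])%E (format "''N[' f ]").

Let r_gt0 : 0 < r.
Proof. by rewrite (lt_le_trans ltr01)// -lee_fin. Qed.

Let mpow (h : T -> R) : measurable_fun setT h ->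
  measurable_fun setT (fun x => (`|h x| `^ r)%:E).
Proof.
move=> mh; apply/measurable_EFinP.
apply: (@measurableT_comp _ _ _ _ _ _ (@powR R ^~ r)) => //.
exact: measurableT_comp.
Qed.

Let Lnorm_leP (h : T -> R) (C : R) : 0 <= C ->
  ('N[h] <= C%:E)%E <-> (\int[mu]_x (`|h x| `^ r)%:E <= (C `^ r)%:E)%E.
Proof.
move=> C0; have rN0 : r != 0 by rewrite gt_eqF.
have -> : (\int[mu]_x (`|h x| `^ r)%:E = 'N[h] `^ r)%E by rewrite poweR_Lnorm.
rewrite -poweR_EFin; split => [hC|hC].
- apply: gt0_ler_poweR => //; first exact: ltW.
  + by rewrite in_itv/= leey andbT Lnorm_ge0.
  + by rewrite in_itv/= leey andbT lee_fin.
- have := @gt0_ler_poweR R r^-1; rewrite invr_ge0 (ltW r_gt0) => /(_ isT).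
  move=> /(_ ('N[h] `^ r)%E (C%:E `^ r)%E); rewrite -!poweRrM !divff//.
  rewrite !poweRe1 ?lee_fin// ?Lnorm_ge0//; apply => //.
  + by rewrite in_itv/= leey andbT poweR_ge0.
  + by rewrite in_itv/= leey andbT lee_fin powR_ge0.
Qed.

Let limn_einf_le (u : (\bar R)^nat) (C : \bar R) (N : nat) :
  (forall n, (N <= n)%N -> (u n <= C)%E) -> (limn_einf u <= C)%E.
Proof.
move=> uC; rewrite limn_einf_lim; apply: lime_le; first exact: is_cvg_einfs.
apply: nearW => n; rewrite (@le_trans _ _ (u (maxn n N)))//.
  by apply: ereal_inf_lbound; exists (maxn n N) => //=; exact: leq_maxl.
exact/uC/leq_maxr.
Qed.

Let e (n : nat) : R := 2^-1 ^+ n.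

Let e_ge0 n : 0 <= e n. Proof. by rewrite exprn_ge0. Qed.

Let sum_e n : \sum_(i < n) e i <= 2.
Proof.
suff -> : \sum_(i < n) e i = 2 - 2 * e n by rewrite gerBl mulr_ge0.
elim: n => [|n IH]; first by rewrite big_ord0 /e expr0 mulr1 subrr.
by rewrite big_ord_recr/= IH /e exprS; lra.
Qed.

Let cvg_powR (u : R^nat) (l : R) : (forall n, 0 <= u n) ->
  u n @[n --> \oo] --> l -> u n `^ r @[n --> \oo] --> l `^ r.
Proof.
move=> u0 ul.
have l0 : 0 <= l.
  rewrite -(cvg_lim _ ul)//; apply: limr_ge; last exact: nearW.
  by apply/cvg_ex; exists l.
move: l0; rewrite le_eqVlt => /predU1P[l0|l0].
  rewrite -l0 in ul *; rewrite powR0 ?gt_eqF//.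
  apply: (squeeze_cvgr _ (cvg_cst 0) ul); near=> n.
  rewrite powR_ge0/=; have := u0 n; rewrite le_eqVlt => /predU1P[<-|un0].
    by rewrite powR0// gt_eqF.
  apply: ge1r_powR => //; rewrite un0/= ltW//.
  by near: n; exact: cvgr_lt ul _ ltr01.
have -> : l `^ r = expR (r * ln l) by rewrite /powR gt_eqF.
apply: (@cvg_trans _ (expR (r * ln (u n)) @[n --> \oo])).
  apply: near_eq_cvg; near=> n; rewrite /powR gt_eqF//.
  by near: n; exact: cvgr_gt ul _ l0.
apply: (@continuous_cvg _ _ _ _ _ _ expR); first exact: continuous_expR.
apply: cvgMl_tmp.
by apply: (@continuous_cvg _ _ _ _ _ _ (@ln R)) => //; exact: continuous_ln.
Unshelve. all: by end_near. Qed.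

Section fast_cauchy.
Variable f : (T -> R)^nat.
Hypothesis mf : forall n, measurable_fun setT (f n).
Hypothesis cf : forall n m, (n <= m)%N -> ('N[f m \- f n] <= (e n)%:E)%E.

Let G N x := \sum_(k < N) `|f k.+1 x - f k x|.

Let mG N : measurable_fun setT (G N).
Proof.
apply: measurable_sum => i; apply: measurableT_comp => //.
exact: measurable_funB.
Qed.

Let G_ge0 N x : 0 <= G N x. Proof. exact: sumr_ge0. Qed.

Let nd_G x : {homo G^~ x : n m / (n <= m)%N >-> n <= m}.
Proof.
apply/nondecreasing_seqP => n.
by rewrite /G big_ord_recr/= lerDl.
Qed.

Let Lnorm_G N : ('N[G N] <= 2%:E)%E.
Proof.
apply: (@le_trans _ _ (\sum_(i < N) e i)%:E); last by rewrite lee_fin sum_e.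
elim: N => [|N IH].
  rewrite big_ord0 (_ : G 0 = cst 0) ?Lnorm0//; last first.
    by apply/funext => x; rewrite /G big_ord0.
  by rewrite gt_eqF.
rewrite (_ : G N.+1 = G N \+ (Num.norm \o (f N.+1 \- f N))); last first.
  by apply/funext => x; rewrite /G big_ord_recr.
rewrite big_ord_recr/= EFinD.
apply: (le_trans (minkowski_EFin _ _ _ _)) => //.
  by apply: measurableT_comp => //; exact: measurable_funB.
apply: leeD => //.
rewrite (_ : 'N[_] = 'N[f N.+1 \- f N]); first exact: cf.
exact: (Lnorm_abse mu (EFin \o (f N.+1 \- f N))).
Qed.

Let cvg_f : \forall x \ae mu, setT x -> cvgn (f^~ x).
Proof.
pose H N x := ((`|G N x| `^ r)%:E : \bar R).
have mH N : measurable_fun setT (H N) by exact: mpow.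
have H0 N x : setT x -> (0 <= H N x)%E by rewrite lee_fin powR_ge0.
have ndH x : setT x -> {homo H^~ x : n m / (n <= m)%N >-> (n <= m)%E}.
  move=> _ n m nm; rewrite lee_fin ge0_ler_powR ?nnegrE ?(ltW r_gt0)//.
  by rewrite !ger0_norm ?nd_G.
have cH := @cvg_monotone_convergence _ _ _ mu _ measurableT _ mH H0 ndH.
pose L x := limn (H^~ x).
have L0 x : (0 <= L x)%E.
  by apply: lime_ge; [exact/ereal_nondecreasing_is_cvgn/ndH|apply: nearW => n; exact: H0].
have mL : measurable_fun setT L.
  apply: (emeasurable_fun_cvg H) => // x _.
  exact/ereal_nondecreasing_is_cvgn/ndH.
have iL : mu.-integrable setT L.
  apply/integrableP; split => //.
  apply: (@le_lt_trans _ _ (2 `^ r)%:E); last exact: ltry.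
  under eq_integral do rewrite gee0_abs//.
  rewrite -(cvg_lim _ cH)//; apply: lime_le; first by apply/cvg_ex; eexists; exact: cH.
  by apply: nearW => N; exact/Lnorm_leP.
apply: filterS (integrable_ae measurableT iL) => x /(_ I) Lx _.
have GL n : G n x <= fine (L x) `^ r^-1.
  rewrite -[leLHS](@powRr1 _ (G n x))// -(mulfV (lt0r_neq0 r_gt0)) powRrM.
  rewrite ge0_ler_powR ?nnegrE ?powR_ge0 ?fine_ge0 ?invr_ge0 ?(ltW r_gt0)//.
  rewrite -lee_fin fineK//.
  have := @ereal_nondecreasing_cvgn _ (H^~ x) (ndH x I).
  move=> /cvg_lim => /(_ (@ereal_hausdorff _)) => HL.
  rewrite /L HL; apply: ereal_sup_ubound; exists n => //=.
  by rewrite /H ger0_norm.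
have cs : cvgn (series (fun n => f n.+1 x - f n x)).
  apply: (@normed_cvg _ R^o).
  have -> : [normed series (fun n => f n.+1 x - f n x)] = G^~ x.
    by apply/funext => n; rewrite /normed_series_of seriesEnat /= big_mkord.
  apply: nondecreasing_is_cvgn; first exact: nd_G.
  by exists (fine (L x) `^ r^-1) => _ [n _ <-].
have -> : f^~ x = (fun n => f 0%N x + series (fun n => f n.+1 x - f n x) n).
  apply/funext => n; exact: (eq_sum_telescope (f^~ x)).
by apply: is_cvgD => //; exact: is_cvg_cst.
Qed.

Lemma fast_cauchy_cvg : exists2 g : T -> R, measurable_fun setT g &
  forall n, ('N[g \- f n] <= (e n)%:E)%E.
Proof.
pose g x := fine (limn_esup (fun n => (f n x)%:E)).
have mg : measurable_fun setT g.
  apply: (@measurableT_comp _ _ _ _ _ _ fine).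
    exact: fine_measurable.
  by apply: measurable_fun_limn_esup => n; exact/measurable_EFinP.
have fg : \forall x \ae mu, setT x -> f n x @[n --> \oo] --> g x.
  apply: filterS cvg_f => x /(_ I) /cvg_ex[l fl] _.
  suff -> : g x = l by [].
  have : (f n x)%:E @[n --> \oo] --> l%:E by apply: cvg_EFin => //; exact: nearW.
  by move=> /cvg_limn_einf_sup[_]; rewrite /g => ->.
exists g => // n; apply/Lnorm_leP => //.
pose H m x := ((`|f m x - f n x| `^ r)%:E : \bar R).
have mH m : measurable_fun setT (H m) by apply: mpow; exact: measurable_funB.
have H0 m x : setT x -> (0 <= H m x)%E by rewrite lee_fin powR_ge0.
rewrite (ae_eq_integral (fun x => limn_einf (H^~ x))) //.
- apply: (le_trans (fatou mu measurableT mH H0)).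
  by apply: (@limn_einf_le _ _ n) => m nm; exact/Lnorm_leP/cf.
- by apply: mpow; exact: measurable_funB.
- rewrite (_ : (fun _ => _) = (fun x => - limn_esup (fun m => - H m x))%E); last first.
    by apply/funext => x; rewrite -(limn_einfN (fun m => - H m x)%E); congr limn_einf; apply/funext => m; exact/esym/oppeK.
  apply: measurableT_comp => //; apply: measurable_fun_limn_esup => m.
  exact: measurableT_comp.
- apply: filterS fg => x /(_ I) fgx _.
  suff : H m x @[m --> \oo] --> (`|g x - f n x| `^ r)%:E.
    by move=> /cvg_limn_einf_sup[->].
  apply: cvg_EFin; first exact: nearW.
  apply: (@cvg_powR (fun m => `|f m x - f n x|)) => //.
  by apply: cvg_norm; apply: cvgB => //; exact: cvg_cst.
Qed.

End fast_cauchy.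

Lemma Lspace_complete (F : set_system Lp) :
  ProperFilter F -> cauchy F -> cvg F.
Proof.
move=> PF /cauchy_ballP cF.
have /choice[u uF] n : exists u : Lp, F (ball u (2^-1 * e n)).
  have /cF Fn : 0 < 2^-1 * e n by rewrite mulr_gt0// exprn_gt0.
  by have [u uF] := filter_ex (nearP_dep Fn); exists u.
have uu n m : (n <= m)%N -> `|u m - u n| <= e n.
  move=> nm; have [v [vn vm]] := filter_ex (filterI (uF n) (uF m)).
  move: vn vm; rewrite -!ball_normE/= => vn vm.
  have em : e m <= e n by rewrite /e ler_wiXn2l// invf_le1// ler1n.
  have := ler_distD v (u m) (u n); rewrite (distrC v (u n)); lra.
have LB (v w : Lp) : `|v - w|%:E = 'N[(v : T -> R) \- w].
  rewrite Lspace_norm_EFin; apply: (@ae_eq_Lnorm _ _ _ mu r%:E r1); last exact: LspaceB.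
    exact: (measurable_Lrepr (v - w)).
  by apply: measurable_funB; exact: measurable_Lrepr.
pose f n : T -> R := u n.
have mf n : measurable_fun setT (f n) by exact: measurable_Lrepr.
have [|g mg gf] := @fast_cauchy_cvg f mf.
  by move=> n m /uu; rewrite -lee_fin LB.
have fing : finite_norm mu r%:E g.
  rewrite /finite_norm (_ : g = (g \- f 0%N) \+ f 0%N); last first.
    by apply/funext => x /=; rewrite subrK.
  apply: (le_lt_trans (minkowski_EFin _ _ _ _)) => //.
    exact: measurable_funB.
  apply: lte_add_pinfty; first by rewrite (le_lt_trans (gf _))// ltry.
  exact: finite_norm_Lrepr.
have gL : g \in Lfun mu r%:E by rewrite inE; apply/andP; rewrite !inE.
pose v := Lclass (Lfun_Sub r1 gL).
have vu n : `|v - u n| <= e n.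
  rewrite -lee_fin LB; apply: le_trans (gf n).
  rewrite (@ae_eq_Lnorm _ _ _ mu r%:E r1 _ (g \- f n))//.
  - by apply: measurable_funB; exact: measurable_Lrepr.
  - exact: measurable_funB.
  - apply: filterS (LclassK (Lfun_Sub r1 gL)) => x /(_ I) vx _.
    exact: (congr1 (fun y => y - f n x) vx).
apply/cvg_ex; exists v; apply/cvg_ballP => eps eps0.
have [n en] : exists n, e n * 2 < eps.
  have h0 : 0 < eps / 2 by rewrite divr_gt0.
  have [n] := filter_ex (near_infty_natSinv_expn_lt (PosNum h0)).
  by rewrite /= div1r -exprVn => en; exists n; rewrite -ltr_pdivlMr.
apply: filterS (uF n) => w; rewrite -!ball_normE/= => uw.
have := vu n; have := ler_distD (u n) v w; have := e_ge0 n; lra.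
Qed.

HB.instance Definition _ := Uniform_isComplete.Build Lp Lspace_complete.
End Lspace_complete.

(* Main.v *)
(** Let [s t = sgn t * |t|^(p-1)], let [e_j] be the normalized indicator of the
    [j]-th set, and choose a nonzero [alpha] in R^3 with [\sum_j s (alpha_j) = 0]
    but [\sum_j alpha_j > 0]: up to sign and scaling, [(1, 1, -2^(1/(p-1)))],
    which works exactly because [p != 2].  Let the [a_i] be the cyclic
    permutations of [alpha] along the [e_j], and [A = {0, a_0, a_1, a_2}].

    The tangent inequality [|t - a|^p >= |a|^p - p (s a) t], summed over [i],
    gives [\sum_i |g - a_i|^p >= \sum_i |a_i|^p] pointwise for every [g], since
    the linear terms cancel; so [0] is a Chebyshev center.  On the other hand
    [\sum_j |1 - u alpha_j|^p <= 3] for small [u > 0], since the derivative at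
    [u = 0] is [- p \sum_j alpha_j < 0]; so, after scaling [alpha], the point
    [0] is farthest in [A] from [e_0 + e_1 + e_2]. *)
Require Import Defs.
From mathcomp Require Import all_boot all_order all_algebra.
From mathcomp Require Import all_classical all_reals all_analysis.
From mathcomp Require Import measurable_realfun lra ring.
Import Order.TTheory GRing.Theory Num.Theory numFieldNormedType.Exports.
Local Open Scope classical_set_scope.
Local Open Scope ring_scope.
Set Implicit Arguments.
Unset Strict Implicit.
Unset Printing Implicit Defensive.

(** * Scalar inequalities and the balanced vector in R^3 *)

(** Young's inequality for [a] and [b ^ (p - 1)], with exponents [p] and [q = p / (p - 1)]: the
    second term becomes [b ^ p / q]. *)
Lemma powR_tangent (R : realType) (p a b : R) : 1 < p -> 0 <= a -> 0 <= b ->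
  b `^ p + p * b `^ (p - 1) * (a - b) <= a `^ p.
Proof.
move=> p1 a0 b0; have p0 : 0 < p by lra.
pose q := p / (p - 1).
have q0 : 0 < q by apply: divr_gt0; lra.
have pq : p^-1 + q^-1 = 1 by rewrite /q invf_div; field; rewrite gt_eqF.
have := conjugate_powR a0 (powR_ge0 b (p - 1)) p0 q0 pq.
rewrite -powRrM (_ : (p - 1) * q = p); last first.
  by rewrite /q mulrC divfK// gt_eqF; lra.
rewrite (_ : b `^ p / q = b `^ p - b `^ p / p); last by rewrite -[q^-1](addKr p^-1) pq; ring.
rewrite -(ler_pM2l p0).
have -> : p * (a `^ p / p + (b `^ p - b `^ p / p)) = a `^ p + (p - 1) * b `^ p.
  by field; rewrite gt_eqF.
have -> : b `^ p = b * b `^ (p - 1).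
  by rewrite mulr_powRB1//.
lra.
Qed.

(** Taking [powR_tangent] at [|t - a|] and [|a|] leaves [|t - a| - |a| >= - Num.sg a * t], a
    triangle inequality split by the sign of [a]. *)
Lemma norm_powR_tangent (R : realType) (p t a : R) : 1 < p ->
  `|a| `^ p - p * (Num.sg a * `|a| `^ (p - 1)) * t <= `|t - a| `^ p.
Proof.
move=> p1; apply: le_trans (powR_tangent p1 (normr_ge0 (t - a)) (normr_ge0 a)).
rewrite lerD2l -subr_ge0.
have -> : p * `|a| `^ (p - 1) * (`|t - a| - `|a|) - - (p * (Num.sg a * `|a| `^ (p - 1)) * t)
  = p * `|a| `^ (p - 1) * (`|t - a| - `|a| + Num.sg a * t) by ring.
rewrite !mulr_ge0 ?powR_ge0//; first lra.
case: (sgrP a) => [a0|a0|a0]; first by rewrite subr0 mul0r addr0.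
  by have := ler_norm (a - t); rewrite distrC; lra.
by have := ler_norm (t - a); lra.
Qed.

Lemma gt1_ltr_powR (R : realType) (a : R) :
  1 < a -> {mono powR a : x y / x < y}.
Proof.
move=> a1 x y; have a0 : 0 < a by exact: lt_trans a1.
by rewrite /powR !gt_eqF// ltr_expR ltr_pM2r ?ln_gt0.
Qed.

(** The tangent is taken at [b = 1 - u * alpha j] and evaluated at [1]. Summing bounds the left side
    by [n] minus [p * u] times a sum that tends to [\sum_j alpha j > 0] as [u] decreases to 0. *)
Lemma sum_powR_subl_le (R : realType) (n : nat) (p : R) (alpha : 'I_n -> R) :
  1 < p -> 0 < \sum_j alpha j ->
  exists2 u, 0 < u & \sum_j `|1 - u * alpha j| `^ p <= n%:R.
Proof.
move=> p1 sum_gt0.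
have cvg_base j : 1 - u * alpha j @[u --> 0^'+] --> (1 : R).
  have : 1 - u * alpha j @[u --> (0 : R)] --> (1 - 0 * alpha j : R).
    by apply: cvgB; [exact: cvg_cst|apply: cvgMr_tmp; exact: cvg_id].
  by rewrite mul0r subr0; exact: cvg_at_right_filter.
have cvg_sum : \sum_j (1 - u * alpha j) `^ (p - 1) * alpha j @[u --> 0^'+]
    --> \sum_j alpha j.
  apply: cvg_big => [|j _]; first exact: add_continuous.
  rewrite -[X in _ --> X]mul1r; apply: cvgMr_tmp.
  rewrite -[X in _ --> X](congr1 (fun f => f (p - 1)) (powR1 R)).
  apply: (@continuous_cvg _ _ _ _ _ _ (fun x : R => x `^ (p - 1))) => //.
  apply: differentiable_continuous; apply/derivable1_diffP.
  have [//] := is_derive1_powR (p - 1) (ltr01 : 0 < (1 : R)).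
have base_gt0 : \forall u \near 0^'+, forall j, 0 < 1 - u * alpha j.
  apply: filter_forall => j; exact: cvgr_gt (cvg_base j) _ ltr01.
have u0 : \forall u \near (0 : R)^'+, 0 < u by exact: nbhs_right_gt.
have [u [[u_gt0 v0] su]] := filter_ex (filterI (filterI u0 base_gt0) (cvgr_gt _ cvg_sum _ sum_gt0)).
exists u => //.
have -> : n%:R = \sum_(j < n) (1 `^ p : R) by rewrite powR1 sumr_const card_ord.
apply: (@le_trans _ _ (\sum_j (1 `^ p - p * u * ((1 - u * alpha j) `^ (p - 1) * alpha j)))).
  apply: ler_sum => j _; rewrite gtr0_norm//.
  by have := powR_tangent p1 ler01 (ltW (v0 j)); rewrite subKr; lra.
rewrite sumrB gerBl -mulr_sumr mulr_ge0 ?(ltW su)// mulr_ge0 ?(ltW u_gt0)//; lra.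
Qed.

Lemma balanced_vector_exists (R : realType) (p : R) : 1 < p < 2 \/ 2 < p ->
  exists alpha : 'I_3 -> R, [/\ exists j, alpha j != 0,
    \sum_j Num.sg (alpha j) * `|alpha j| `^ (p - 1) = 0 &
    \sum_j `|1 - alpha j| `^ p <= 3].
Proof.
move=> hp; have p1 : 1 < p by case: hp => [/andP[]|] //; lra.
pose k := 2 `^ (p - 1)^-1 : R.
have k_gt0 : 0 < k by exact: powR_gt0.
have kE : k `^ (p - 1) = 2 by rewrite /k -powRrM mulVf ?powRr1//; lra.
(* The entries of [beta] sum to [s * (2 - k)], and [k > 2] when [p < 2], [k < 2] when [p > 2]; [s]
   makes the sum positive. *)
pose s : R := if p < 2 then -1 else 1.
have s1 : `|s| = 1 by rewrite /s; case: ifP; rewrite ?normrN normr1.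
pose beta (j : 'I_3) := if j == ord_max then - (s * k) else s.
have sum_gt0 : 0 < \sum_j beta j.
  rewrite !big_ord_recl big_ord0 /beta/= addr0.
  rewrite /s; case: (ltP p 2) => p2.
  - have : 2 `^ 1 < k by rewrite /k gt1_ltr_powR// ?invf_gt1; lra.
    rewrite powRr1//; lra.
  - have {}p2 : 2 < p by case: hp => //; lra.
    have : k < 2 `^ 1 by rewrite /k gt1_ltr_powR// ?invf_lt1; lra.
    rewrite powRr1//; lra.
have [u u0 hu] := sum_powR_subl_le p1 sum_gt0.
(* Scaling by [u > 0] multiplies the balance sum by [u ^ (p - 1)], so it still vanishes. *)
exists (fun j => u * beta j); split => //.
  exists ord0; apply: mulf_neq0; first by rewrite gt_eqF.
  by rewrite /beta/= -normr_eq0 s1 oner_eq0.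
rewrite !big_ord_recl big_ord0 /beta/= !normrM normrN normrM s1 !(gtr0_norm u0) (gtr0_norm k_gt0).
rewrite !sgrM sgrN sgrM (gtr0_sg u0) (gtr0_sg k_gt0) !mul1r !mulr1 powRM ?(ltW u0) ?(ltW k_gt0)// kE.
ring.
Qed.

(** * A metric criterion for CCF spaces *)

(** In [A = {0} U range a], the radius from [0] is [N] and no [y] does better, so [0] is a Chebyshev
    center; it is also farthest from [x]. Since [N > 0], [0] and [a i0] differ. *)
Lemma CCF_space_of_family (R : realType) (X : completeNormedModType R)
    (I : Type) (i0 : I) (a : I -> X) (N : R) (x : X) :
  0 < N -> (forall i, `|a i| = N) -> (forall y, exists i, N <= `|y - a i|) ->
  (forall i, `|x - a i| <= `|x|) -> CCF_space X.
Proof.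
move=> N0 aN centre far; pose A := 0 |` range a.
have A0 : A 0 by left.
have Aa i : A (a i) by right; exists i.
have dist_le y b : A b -> `|y - b| <= `|y| + N.
  case=> [->|[i _ <-]]; first by rewrite subr0 lerDl ltW.
  by rewrite -(aN i) ler_normB.
have le_radius y b : A b -> `|y - b| <= far_radius y A.
  move=> Ab; apply: ub_le_sup; last by exists b.
  by exists (`|y| + N); move=> _ [c Ac <-]; exact: dist_le.
have radius_le y r : (forall b, A b -> `|y - b| <= r) -> far_radius y A <= r.
  move=> h; apply: ge_sup; first by exists `|y - 0|; exists 0.
  by move=> _ [b Ab <-]; exact: h.
have radius0 : far_radius 0 A = N.
  apply/eqP; rewrite eq_le; apply/andP; split.
    by apply: radius_le => b Ab; have := dist_le 0 b Ab; rewrite normr0 (add0r N).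
  by have := le_radius 0 _ (Aa i0); rewrite sub0r normrN aN.
have radius_ge y : N <= far_radius y A.
  by have [i /le_trans] := centre y; apply; exact: le_radius.
have bA : bounded_set A.
  apply: filterS (nbhs_pinfty_ge (num_real N)) => M NM b Ab /=.
  by apply: le_trans NM; have := dist_le 0 b Ab; rewrite sub0r normrN normr0 add0r.
exists A; split => //.
  by exists 0, (a i0); split => // a0; move: N0; rewrite -(aN i0) -a0 normr0 ltxx.
split => //; first by exists 0.
exists 0.
  rewrite /chebyshev_center radius0; apply/eqP; rewrite eq_le; apply/andP; split.
    apply: lb_le_inf; first by exists (far_radius 0 A); exists 0.
    by move=> _ [y _ <-].
  rewrite -radius0; apply: ge_inf; last by exists 0.
  by exists N; move=> _ [y _ <-].
exists x => //; split => //; apply/eqP; rewrite eq_le le_radius//=.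
by apply: radius_le => b [->|[i _ <-]]; rewrite subr0// far.
Qed.

(** * Step functions in L_p *)

Lemma measurable_norm_powR d (T : measurableType d) (R : realType) (p : R)
    (f : T -> R) : measurable_fun setT f ->
  measurable_fun setT (fun x => (`|f x| `^ p)%:E).
Proof.
move=> mf; apply/measurable_EFinP.
apply: (@measurableT_comp _ _ _ _ _ _ (@powR R ^~ p)) => //.
exact: measurableT_comp.
Qed.

Section Lp.
Context d (T : measurableType d) (R : realType).
Variables (mu : {measure set T -> \bar R}) (p : R) (p1 : (1 <= p%:E)%E).
Local Notation Lp := (LspaceType mu p1).

Let p_gt0 : 0 < p. Proof. by rewrite (lt_le_trans ltr01)// -lee_fin. Qed.

(** This allows norms to be computed on any explicit measurable representative. *)
Lemma Lspace_norm_powR (f : Lp) (g : T -> R) :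
  measurable_fun setT g -> ae_eq mu setT f g ->
  (`|f| `^ p)%:E = (\int[mu]_x (`|g x| `^ p)%:E)%E.
Proof.
move=> mg fg; rewrite -poweR_EFin Lspace_norm_EFin.
rewrite (ae_eq_Lnorm p1 (measurable_Lrepr f) mg fg) poweR_Lnorm//.
by rewrite gt_eqF.
Qed.

Section step.
Variables (n : nat) (D : 'I_n -> set T).
Hypothesis mD : forall j, measurable (D j).
Hypothesis tD : trivIset setT D.
Hypothesis D_pos : forall j, (0 < mu (D j) < +oo)%E.

Let m j := fine (mu (D j)).

Let m_gt0 j : 0 < m j.
Proof. by apply: fine_gt0; have /andP[-> ->] := D_pos j. Qed.

Let mE j : mu (D j) = (m j)%:E.
Proof. by rewrite fineK// ge0_fin_numE//; have /andP[] := D_pos j. Qed.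

(** The factor [mu (D j) ^ (-1/p)] gives each scaled indicator norm 1, so that [c] is sent
    isometrically from l_p^n into L_p. *)
Definition step_fun (c : 'I_n -> R) (x : T) : R :=
  \sum_j c j * (fine (mu (D j)) `^ (- p^-1) * \1_(D j) x).

Lemma measurable_step_fun c : measurable_fun setT (step_fun c).
Proof.
by apply: measurable_sum => j; do 2!(apply: measurable_funM => //).
Qed.

Lemma step_fun_in c j x : D j x -> step_fun c x = c j * m j `^ (- p^-1).
Proof.
move=> Djx; rewrite /step_fun (bigD1 j)//= big1 ?addr0; last first.
  move=> i ij; rewrite indicE memNset ?mulr0// => Dix.
  by move/eqP: ij; apply; apply: tD => //; exists x.
by rewrite indicE mem_set// mulr1.
Qed.

Lemma step_fun_out c x : (forall j, ~ D j x) -> step_fun c x = 0.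
Proof.
by move=> Dx; rewrite /step_fun big1// => j _; rewrite indicE memNset ?mulr0.
Qed.

Lemma integral_step_fun c :
  (\int[mu]_x (`|step_fun c x| `^ p)%:E)%E = (\sum_j `|c j| `^ p)%:E.
Proof.
(* By disjointness at most one term of the step function is nonzero at [x], so the power of the sum
   is the sum of the powers. *)
have -> : (fun x => (`|step_fun c x| `^ p)%:E) =
    (fun x => \sum_(j < n) ((`|c j| `^ p / m j)%:E * (\1_(D j) x)%:E))%E.
  apply/funext => x; have [[j Djx]|Dx] := pselect (exists j, D j x).
    rewrite (step_fun_in _ Djx) (bigD1 j)//= big1 ?adde0; last first.
      move=> i ij; rewrite indicE memNset ?mule0// => Dix.
      by move/eqP: ij; apply; apply: tD => //; exists x.
    rewrite indicE mem_set// mule1 normrM powRM// (ger0_norm (powR_ge0 _ _)) -powRrM.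
    by rewrite mulNr mulVf ?gt_eqF// powR_inv1// ltW.
  rewrite step_fun_out; last by move=> j Djx; apply: Dx; exists j.
  rewrite normr0 powR0 ?gt_eqF// big1// => j _.
  by rewrite indicE memNset ?mule0// => Djx; apply: Dx; exists j.
have c0 j : 0 <= `|c j| `^ p / m j by rewrite mulr_ge0 ?powR_ge0// invr_ge0 ltW.
have mI j : measurable_fun setT (EFin \o (\1_(D j) : T -> R)).
  exact/measurable_EFinP.
rewrite ge0_integral_sum//; last first.
- by move=> j x _; rewrite mule_ge0// lee_fin.
- by move=> j; apply: emeasurable_funM; [exact: measurable_cst|exact: mI].
rewrite -sumEFin; apply: eq_bigr => j _.
rewrite ge0_integralZl_EFin//; last exact: mI.
rewrite integral_indic// setIT mE -EFinM divfK//.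
by rewrite gt_eqF.
Qed.

Lemma step_fun_Lfun c : step_fun c \in Lfun mu p%:E.
Proof.
rewrite inE; apply/andP; rewrite !inE; split; first exact: measurable_step_fun.
(* Raising the norm to the exponent [1 = p * p^-1] exposes its [p]-th power, the integral just
   computed. *)
rewrite /= /finite_norm -(@poweRe1 _ 'N[mu]_p%:E[EFin \o step_fun c]%E) ?Lnorm_ge0//.
rewrite -(mulfV (lt0r_neq0 p_gt0)) poweRrM poweR_Lnorm ?gt_eqF//.
by rewrite (integral_step_fun c) poweR_EFin ltry.
Qed.

Definition step c : Lp := Lclass (Lfun_Sub p1 (step_fun_Lfun c)).

Lemma step_ae c : ae_eq mu setT (step c) (step_fun c).
Proof. exact: (LclassK (Lfun_Sub p1 (step_fun_Lfun c))). Qed.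

Lemma norm_step c : `|step c| `^ p = \sum_j `|c j| `^ p.
Proof.
apply: EFin_inj; rewrite -integral_step_fun; apply: Lspace_norm_powR.
  exact: measurable_step_fun.
exact: step_ae.
Qed.

Lemma norm_stepB c c' : `|step c - step c'| `^ p = \sum_j `|c j - c' j| `^ p.
Proof.
apply: EFin_inj; rewrite -integral_step_fun; apply: Lspace_norm_powR.
  exact: measurable_step_fun.
apply: (ae_eq_trans (LspaceB _ _)).
apply: filterS2 (step_ae c) (step_ae c') => x /(_ I) cx /(_ I) cx' _.
rewrite /= cx cx' /step_fun -sumrB; apply: eq_bigr => j _.
by rewrite mulrBl.
Qed.

(** The inequality already holds pointwise: on [D j] the values are the [c i j] times a common
    positive factor, hence balanced over [i], and off the [D j] they vanish. Integration then gives
    the norms. *)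
Lemma sum_norm_step_le (J : finType) (c : J -> 'I_n -> R) (g : Lp) :
  1 < p -> (forall j, \sum_i Num.sg (c i j) * `|c i j| `^ (p - 1) = 0) ->
  \sum_i `|step (c i)| `^ p <= \sum_i `|g - step (c i)| `^ p.
Proof.
move=> p_gt1 balanced.
have pw x : \sum_i `|step_fun (c i) x| `^ p <= \sum_i `|g x - step_fun (c i) x| `^ p.
  have sum0 : \sum_i Num.sg (step_fun (c i) x) * `|step_fun (c i) x| `^ (p - 1) = 0.
    have [[j Djx]|Dx] := pselect (exists j, D j x); last first.
      rewrite big1// => i _; rewrite step_fun_out ?sgr0 ?mul0r//.
      by move=> j Djx; apply: Dx; exists j.
    have mj : 0 < m j `^ (- p^-1) by exact: powR_gt0.
    apply: etrans (mul0r ((m j `^ (- p^-1)) `^ (p - 1))).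
    rewrite -[X in _ = X * _](balanced j) mulr_suml.
    apply: eq_bigr => i _; rewrite (step_fun_in _ Djx) sgrM normrM (gtr0_sg mj) mulr1.
    by rewrite (gtr0_norm mj) powRM// ?mulrA// ltW.
  (* Subtracting [p * g x] times the vanishing sum turns the left side into a sum of tangent
     values. *)
  rewrite -[leLHS]subr0 -[X in _ - X](mulr0 (p * g x)) -[X in _ * X]sum0.
  rewrite mulr_sumr -sumrB.
  apply: ler_sum => i _.
  by have := norm_powR_tangent (g x) (step_fun (c i) x) p_gt1; lra.
have mg : measurable_fun setT (g : T -> R) := measurable_Lrepr g.
have mB i : measurable_fun setT (fun x => g x - step_fun (c i) x).
  by apply: measurable_funB => //; exact: measurable_step_fun.
rewrite -lee_fin -!sumEFin.
under eq_bigr do rewrite (Lspace_norm_powR (@measurable_step_fun _) (step_ae _)).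
under [leRHS]eq_bigr => i _.
  rewrite (Lspace_norm_powR (g := fun x => g x - step_fun (c i) x))//; last first.
    apply: (ae_eq_trans (LspaceB _ _)).
    by apply: filterS (step_ae (c i)) => x /(_ I) cx _; rewrite /= cx.
  over.
rewrite -!ge0_integral_sum//.
- apply: ge0_le_integral => //.
  + by move=> x _; apply: sume_ge0 => i _; rewrite lee_fin powR_ge0.
  + by apply: emeasurable_sum => i; apply: measurable_norm_powR; exact: measurable_step_fun.
  + by apply: emeasurable_sum => i; apply: measurable_norm_powR.
  + by move=> x _; rewrite !sumEFin lee_fin.
- by move=> i; exact: measurable_norm_powR.
- by move=> i; apply: measurable_norm_powR; exact: measurable_step_fun.
Qed.

End step.
End Lp.

(** * Cyclic shifts of the balanced vector in L_p *)

Theorem theorem3p3 (R : realType) (d : measure_display) (Omega : measurableType d)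
    (mu : {measure set Omega -> \bar R})
    (mu_finite_or_sigma_finite : fin_num_fun mu \/ sigma_finite [set: Omega] mu)
    (Delta1 Delta2 Delta3 : set Omega)
    (mDelta1 : measurable Delta1)
    (mDelta2 : measurable Delta2)
    (mDelta3 : measurable Delta3)
    (disj12 : Delta1 `&` Delta2 = set0)
    (disj13 : Delta1 `&` Delta3 = set0)
    (disj23 : Delta2 `&` Delta3 = set0)
    (mu_Delta1 : (0 < mu Delta1 < +oo)%E)
    (mu_Delta2 : (0 < mu Delta2 < +oo)%E)
    (mu_Delta3 : (0 < mu Delta3 < +oo)%E)
    (p : R) (p1 : (1 <= p%:E)%E)
    (hp : 1 < p < 2 \/ 2 < p) :
  CCF_space (LspaceType mu p1 : completeNormedModType R).
Proof.
have p_gt1 : 1 < p by case: hp => [/andP[]|] //; exact/lt_trans/ltr1n.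
have p_gt0 : 0 < p by exact: lt_trans p_gt1.
pose D (j : 'I_3) := nth set0 [:: Delta1; Delta2; Delta3] j.
have mD j : measurable (D j) by case: j => [[|[|[|]]]].
have tD : trivIset setT D.
  apply/trivIsetP => -[[|[|[|//]]] i3] [[|[|[|//]]] j3] _ _ //=; rewrite /D /= => _ //;
    by rewrite setIC.
have D_pos j : (0 < mu (D j) < +oo)%E by case: j => [[|[|[|]]]].
have [alpha [[j0 alpha0] balanced far]] := balanced_vector_exists hp.
pose e := step p1 mD tD D_pos.
(* Here [i + j] is addition modulo 3, so rows and columns of [alpha (i + j)] both permute [alpha]:
   rows give equal norms, columns give balance. *)
pose a (i : 'I_3) := e (fun j => alpha (i + j)).
have cyclic (F : R -> R) i : \sum_j F (alpha (i + j)) = \sum_j F (alpha j).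
  by rewrite [RHS](reindex_inj (addrI i)).
have cyclic' (F : R -> R) j : \sum_i F (alpha (i + j)) = \sum_i F (alpha i).
  by rewrite [RHS](reindex_inj (addIr j)).
pose S := \sum_j `|alpha j| `^ p.
have S_gt0 : 0 < S.
  apply: (@lt_le_trans _ _ (`|alpha j0| `^ p)); first by rewrite powR_gt0 ?normr_gt0.
  by rewrite /S (bigD1 j0)//= lerDl sumr_ge0// => j _; rewrite powR_ge0.
have a_powR i : `|a i| `^ p = S.
  by rewrite norm_step (cyclic (fun t => `|t| `^ p)).
have powRK (t : R) : 0 <= t -> (t `^ p) `^ p^-1 = t.
  by move=> t0; rewrite -powRrM mulfV ?powRr1 ?gt_eqF.
have powR_le (s t : R) : 0 <= s -> 0 <= t -> s `^ p <= t `^ p -> s <= t.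
  move=> s0 t0; rewrite -{2}(powRK s)// -{2}(powRK t)//.
  by apply: ge0_ler_powR; rewrite ?nnegrE ?powR_ge0 ?invr_ge0 ?(ltW p_gt0).
apply: (@CCF_space_of_family _ _ _ ord0 a (S `^ p^-1) (e (fun=> 1))).
- exact: powR_gt0.
- by move=> i; rewrite -(a_powR i) powRK.
(* If every [|y - a i|] were below the common norm, the sum of their [p]-th powers would be below
   [\sum_i |a i| ^ p], against [sum_norm_step_le]. *)
- move=> y; apply: contrapT => /forallNP near_y.
  have := sum_norm_step_le mD tD D_pos (c := fun i j => alpha (i + j)) y p_gt1.
  move=> /(_ (fun j => etrans (cyclic' (fun t => Num.sg t * `|t| `^ (p - 1)) j) balanced)).
  apply/negP; rewrite -ltNge; apply: ltr_sum; first by apply/hasP; exists ord0; rewrite ?mem_index_enum.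
  move=> i _; rewrite -/e -/(a i) a_powR.
  have /negP := near_y i; rewrite -ltNge => /(gt0_ltr_powR p_gt0).
  rewrite -powRrM mulVf ?powRr1 ?gt_eqF ?ltW//; apply; rewrite nnegrE ?powR_ge0//.
(* In [p]-th powers this is [\sum_j |1 - alpha j| ^ p <= 3], as the all-ones step function has norm
   power 3. *)
- move=> i; apply: powR_le => //.
  rewrite norm_stepB norm_step (cyclic (fun t => `|1 - t| `^ p)).
  under [leRHS]eq_bigr do rewrite normr1 powR1.
  by rewrite sumr_const card_ord.
Qed.
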